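(* Let $A$ be a separable unital C*-algebra with at least one tracial state. Then the group $U_0(A)$ admits discontinuous group automorphisms (with respect to the norm topology).
   Context: $U_0(A)$ denotes the connected component of the identity in the unitary group of $A$, endowed with the norm topology. *)

(* Defs.v *)
From HB Require Import structures.
From mathcomp Require Import all_boot all_order all_algebra.
From mathcomp Require Import complex.
From mathcomp Require Import all_classical all_reals all_analysis.

Set Implicit Arguments.
Unset Strict Implicit.
Unset Printing Implicit Defensive.

Import Order.TTheory GRing.Theory Num.Theory.
Import numFieldNormedType.Exports.

Local Open Scope classical_set_scope.
Local Open Scope complex_scope.
Local Open Scope ring_scope.

(* An HB structure inheriting from both [algType] and [completeNormedModType]
   is rejected, because [numDomainType] is already declared as the join of
   rings and normed groups. A unital C*-algebra is therefore a complex Banach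
   space together with the remaining operations, and its carrier
   [cstar_sort A] is equipped below with both library structures.
   - The norm of a normed module over [R[i]] takes its values in [R[i]], where
     [x <= y] means that [y - x] is a nonnegative real.
   - [cstar_oner_neq0] excludes only the zero algebra, which has no state. *)
Record cstarAlgebra (R : realType) := CStarAlgebra {
  cstar_banach : completeNormedModType R[i];
  cstar_one : cstar_banach;
  cstar_mul : cstar_banach -> cstar_banach -> cstar_banach;
  cstar_star : cstar_banach -> cstar_banach;
  cstar_mulA : associative cstar_mul;
  cstar_mul1l : left_id cstar_one cstar_mul;
  cstar_mul1r : right_id cstar_one cstar_mul;
  cstar_mulDl : left_distributive cstar_mul +%R;
  cstar_mulDr : right_distributive cstar_mul +%R;
  cstar_scaleAl : forall (c : R[i]) x y,
    c *: cstar_mul x y = cstar_mul (c *: x) y;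
  cstar_scaleAr : forall (c : R[i]) x y,
    c *: cstar_mul x y = cstar_mul x (c *: y);
  cstar_oner_neq0 : cstar_one != 0;
  cstar_normM : forall x y, `|cstar_mul x y| <= `|x| * `|y|;
  cstar_starK : involutive cstar_star;
  cstar_starD : {morph cstar_star : x y / x + y};
  cstar_starZ : forall (c : R[i]) x,
    cstar_star (c *: x) = Num.conj c *: cstar_star x;
  cstar_starM : forall x y,
    cstar_star (cstar_mul x y) = cstar_mul (cstar_star y) (cstar_star x);
  cstar_norm_starM : forall x, `|cstar_mul (cstar_star x) x| = `|x| ^+ 2
}.

Definition cstar_sort (R : realType) (A : cstarAlgebra R) : Type :=
  cstar_banach A.
Coercion cstar_sort : cstarAlgebra >-> Sortclass.

Section CStarInstances.
Variables (R : realType) (A : cstarAlgebra R).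

HB.instance Definition _ :=
  CompleteNormedModule.copy (cstar_sort A) (cstar_banach A).

HB.instance Definition _ :=
  GRing.Zmodule_isNzRing.Build (cstar_sort A)
    (@cstar_mulA R A) (@cstar_mul1l R A) (@cstar_mul1r R A)
    (@cstar_mulDl R A) (@cstar_mulDr R A) (@cstar_oner_neq0 R A).

HB.instance Definition _ :=
  GRing.Lmodule_isLalgebra.Build R[i] (cstar_sort A) (@cstar_scaleAl R A).

HB.instance Definition _ :=
  GRing.Lalgebra_isAlgebra.Build R[i] (cstar_sort A) (@cstar_scaleAr R A).

Definition star : A -> A := @cstar_star R A.

End CStarInstances.

Definition separable_space (T : topologicalType) : Prop :=
  exists2 D : set T, countable D & dense D.

Definition tracial_state (R : realType) (A : cstarAlgebra R)
    (tau : {scalar A}) : Prop :=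
  [/\ forall a : A, 0 <= tau (star a * a),
      tau 1 = 1
    & forall a b : A, tau (a * b) = tau (b * a)].

Definition unitary_group (R : realType) (A : cstarAlgebra R) : set A :=
  [set u | star u * u = 1 /\ u * star u = 1].
Arguments unitary_group {R} A _.

Definition U0 (R : realType) (A : cstarAlgebra R) : set A :=
  connected_component (unitary_group A) 1.
Arguments U0 {R} A _.

(* [G] is meant to be a group under the multiplication of [M]; the values of
   [phi] outside [G] are irrelevant. *)
Definition group_automorphism (M : pzRingType) (G : set M) (phi : M -> M)
    : Prop :=
  set_bij G G phi /\ {in G &, {morph phi : u v / u * v}}.

(* Main.v *)
(* Let [U] be the unitary group, [tau] a tracial state, and write [e(t)] for the
   scalar unitary [exp (i t)]. On a ball around [1] the map [tau o log] turns
   products into sums and is invariant under conjugation by unitaries. Hence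
   moving the entries of a product of [n] commutators a little multiplies it by
   some [z] near [1] with [tau (log z) = 0]; if the two products are [e(t)] and
   [e(t')], then [z = e(t' - t)] is a scalar, so [z = 1]. As [A] is separable,
   the set [K] of the [t] with [e(t)] in the derived subgroup of [U] is thus
   countable. Choose [t0] none of whose positive multiples lies in [K + Q]. The
   divisibility of [Q] gives a homomorphism [f : U -> Q] with [f (e(q)) = 0] for
   [q] in [Q] and [f (e(t0)) = 1]. Then [u |-> e(f u) u] has inverse
   [u |-> e(- f u) u] and maps [U_0(A)] onto itself; it fixes every [e(q)], and
   these accumulate at [e(t0)], but it does not fix [e(t0)]. *)
Require Import Defs.
From HB Require Import structures.
From mathcomp Require Import all_boot all_order all_algebra.
From mathcomp Require Import generic_quotient complex.
From mathcomp Require Import all_classical all_reals all_analysis.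
From mathcomp Require Import ring lra.

Set Implicit Arguments.
Unset Strict Implicit.
Unset Printing Implicit Defensive.

Import Order.TTheory GRing.Theory Num.Theory.
Import numFieldNormedType.Exports.

Local Open Scope classical_set_scope.
Local Open Scope complex_scope.
Local Open Scope ring_scope.

(** * Rational characters of abelian groups *)

Definition zmod_subgroup (V : zmodType) (S : set V) : Prop :=
  S 0 /\ forall x y, S x -> S y -> S (x - y).

Section ZmodSubgroup.
Variables (V : zmodType) (S : set V).
Hypothesis subS : zmod_subgroup S.

Lemma zmod_subgroupN x : S x -> S (- x).
Proof. by case: subS => S0 SB Sx; rewrite -sub0r; apply: SB. Qed.

Lemma zmod_subgroupD x y : S x -> S y -> S (x + y).
Proof.
by case: subS => S0 SB Sx Sy; rewrite -[y]opprK; apply/SB/zmod_subgroupN.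
Qed.

Lemma zmod_subgroupMz x (z : int) : S x -> S (x *~ z).
Proof.
move=> Sx; have Sn n : S (x *+ n).
  by elim: n => [|n IHn]; [case: subS | rewrite mulrS; apply: zmod_subgroupD].
by case: z => n; [exact: Sn | rewrite NegzE mulrNz; apply/zmod_subgroupN/Sn].
Qed.

End ZmodSubgroup.

Section RationalCharacter.
Variables (V : zmodType) (S : set V) (v : V).
Hypothesis subS : zmod_subgroup S.
Hypothesis freev : forall n, ~ S (v *+ n.+1).

(** Zorn's lemma gives [M] maximal among the subgroups that contain [S] and no positive multiple of
    [v]. If [g] lies outside [M], the subgroup generated by [M] and [g] contains such a multiple,
    which is the required relation between [g] and [v]. *)
Lemma maximal_subgroup_avoiding_multiples :
  exists M : set V, [/\ zmod_subgroup M, S `<=` M,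
    forall z : int, M (v *~ z) -> z = 0
  & forall g, exists k n : int, k != 0 /\ M (g *~ k - v *~ n)].
Proof.
(* The conditions bear on the union of [X] with [S], so that the empty chain, whose union is empty,
   satisfies them too. *)
pose P (X : set V) :=
  zmod_subgroup (X `|` S) /\ forall n, ~ (X `|` S) (v *+ n.+1).
have [F FP totF|M0 [[subM freeM] maxM]] := @Zorn_bigcup V P.
  have [[X0 FX0]|noX] := pselect (exists X, F X); last first.
    have -> : \bigcup_(X in F) X = set0.
      by apply/seteqP; split=> // x [X FX]; case: noX; exists X.
    by rewrite /P set0U.
  have cup x : (\bigcup_(X in F) X `|` S) x -> exists2 X, F X & (X `|` S) x.
    by move=> [[X FX Xx]|Sx]; [exists X => //; left | exists X0 => //; right].
  have cupI X x : F X -> (X `|` S) x -> (\bigcup_(X in F) X `|` S) x.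
    by move=> FX [Xx|Sx]; [left; exists X | right].
  split=> [|n /cup[X /FP[_ +] /[dup] Xn]]; last by move=> /(_ n).
  split=> [|x y /cup[X FX Xx] /cup[Y FY Yy]].
    by right; case: subS.
  have [XY|YX] := totF _ _ FX FY.
    apply: (cupI Y) => //; have [[_ B] _] := FP _ FY; apply: B => //.
    by case: Xx => [/XY|]; [left | right].
  apply: (cupI X) => //; have [[_ B] _] := FP _ FX; apply: B => //.
  by case: Yy => [/YX|]; [left | right].
pose M := M0 `|` S; rewrite -/M in subM freeM.
exists M; split=> //.
- by move=> x Sx; right.
- case=> [[//|n] /freeM//|n]; rewrite NegzE mulrNz.
  by move=> /(zmod_subgroupN subM); rewrite opprK => /freeM.
move=> g; have [Mg|Mg] := pselect (M g).
  by exists 1, 0; rewrite mulr1z mulr0z subr0.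
pose M' := [set x | exists2 m, M m & exists z : int, x = m + g *~ z].
have MM' : M `<=` M'.
  by move=> m Mm; exists m => //; exists 0; rewrite mulr0z addr0.
have M'S : M' `|` S = M'.
  by apply/seteqP; split=> [x [//|Sx]|x ?]; [apply/MM'; right | left].
have sM' : zmod_subgroup M'.
  split=> [|x y [m Mm [z ->]] [m' Mm' [z' ->]]].
    by apply: MM'; case: subM.
  exists (m - m'); first by case: subM => _; apply.
  by exists (z - z'); rewrite mulrzBr opprD addrACA.
have : ~ P M'.
  apply: maxM; rewrite properEneq; split; last first.
    by move=> x M0x; apply: MM'; left.
  apply/eqP => M0M'; apply: Mg; left; rewrite M0M'.
  by exists 0; [case: subM | exists 1; rewrite mulr1z add0r].
rewrite /P M'S => /not_andP[//|/existsNP[n /contrapT [m Mm [z vmz]]]].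
have z0 : z != 0.
  apply/eqP => z0; move: vmz; rewrite z0 mulr0z addr0 => vm.
  by apply: (freeM n); rewrite vm.
exists z, n.+1; split=> //.
rewrite -[v *~ _]/(v *+ n.+1) vmz opprD addrCA subrr addr0.
exact: zmod_subgroupN.
Qed.

(* [f g = n / k] as soon as [k g = n v] modulo a maximal subgroup meeting the
   multiples of [v] trivially. *)
Lemma exists_rational_character : exists f : V -> rat,
  [/\ {morph f : x y / x + y}, forall x, S x -> f x = 0 & f v = 1].
Proof.
have [M [subM SM freeM /choice[k /choice[n kn]]]] :=
  maximal_subgroup_avoiding_multiples.
pose f g : rat := (n g)%:~R / (k g)%:~R.
(* Cross-multiplying two relations for the same [g] leaves a multiple of [v] in [M]. Its multiplier
   must vanish, so the quotient does not depend on the chosen pair. *)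
have fE g (k' n' : int) : k' != 0 -> M (g *~ k' - v *~ n') ->
    f g = n'%:~R / k'%:~R.
  move=> k'0 Mg; have [k0 Mkn] := kn g; have := zmod_subgroupMz subM k' Mkn.
  have := zmod_subgroupMz subM (k g) Mg => /[swap] Mk'.
  case: (subM) => _ /[apply] /(_ _ Mk').
  rewrite !mulrzBl -!mulrzA [k' * k g]mulrC opprB addrC subrKA.
  rewrite -mulrzBr => /freeM /eqP; rewrite subr_eq0 => /eqP nk.
  apply/eqP; rewrite /f eqr_div ?intr_eq0// -!intrM.
  by rewrite nk.
exists f; split=> [x y|x Sx|].
- have [kx Mx] := kn x; have [ky My] := kn y.
  rewrite (fE (x + y) (k x * k y) (n x * k y + n y * k x)).
  + by rewrite intrD !intrM /f addf_div ?intr_eq0.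
  + by rewrite mulf_neq0.
  + have := zmod_subgroupD subM (zmod_subgroupMz subM (k y) Mx)
      (zmod_subgroupMz subM (k x) My).
    rewrite !mulrzBl -!mulrzA [k y * k x]mulrC mulrzDl mulrzDr.
    by rewrite addrACA opprD.
- by rewrite (fE x 1 0) ?mul0r// mulr0z mulr1z subr0; apply: SM.
- rewrite (fE v 1 1) ?divr1// subrr; by case: subM.
Qed.

End RationalCharacter.

(** * Abelianization *)

Section Abelianization.
Variable G : groupType.
Implicit Types (x y z : G) (s : seq (G * G)).
Local Open Scope group_scope.
Local Open Scope quotient_scope.

Definition prod_comm s : G := \prod_(p <- s) [~ p.1, p.2].

Lemma prod_comm_cons p s : prod_comm (p :: s) = [~ p.1, p.2] * prod_comm s.
Proof. by rewrite /prod_comm big_cons. Qed.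

(** Inverses of commutators are commutators, so products suffice. The explicit list of pairs is what
    is later discretised and perturbed entry by entry. *)
Definition derived_subgroup : set G := range prod_comm.

Lemma derived_subgroupM x y :
  derived_subgroup x -> derived_subgroup y -> derived_subgroup (x * y).
Proof.
by move=> [s _ <-] [t _ <-]; exists (s ++ t); rewrite // /prod_comm big_cat.
Qed.

Lemma derived_subgroupR x y : derived_subgroup [~ x, y].
Proof. by exists [:: (x, y)]; rewrite // /prod_comm big_seq1. Qed.

Lemma derived_subgroup1 : derived_subgroup 1.
Proof. by exists [::]; rewrite // /prod_comm big_nil. Qed.

Lemma derived_subgroupV x : derived_subgroup x -> derived_subgroup x^-1.
Proof.
move=> [s _ <-]; elim: s => [|p s IHs].
  by rewrite /prod_comm big_nil invg1; apply: derived_subgroup1.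
rewrite prod_comm_cons invgM invgR.
exact/derived_subgroupM/derived_subgroupR.
Qed.

Lemma derived_subgroupJ x y : derived_subgroup x -> derived_subgroup (x ^ y).
Proof.
move=> Gx; have -> : x ^ y = x * [~ x, y] by rewrite commgEl mulVKg.
exact/derived_subgroupM/derived_subgroupR.
Qed.

Definition derived_eqv x y : bool := `[< derived_subgroup (x / y) >].

Lemma derived_eqv_refl : reflexive derived_eqv.
Proof. by move=> x; apply/asboolP; rewrite mulgV; apply: derived_subgroup1. Qed.

Lemma derived_eqv_sym : symmetric derived_eqv.
Proof.
move=> x y; apply/asboolP/asboolP => /derived_subgroupV;
  by rewrite invgF.
Qed.

Lemma derived_eqv_trans : transitive derived_eqv.
Proof.
move=> y x z /asboolP xy /asboolP yz; apply/asboolP.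
by rewrite -(divgKA y x z^-1); apply: derived_subgroupM.
Qed.

Canonical derived_equiv :=
  EquivRel derived_eqv derived_eqv_refl derived_eqv_sym derived_eqv_trans.

Definition abelianization := {eq_quot derived_equiv}.

HB.instance Definition _ := Choice.on abelianization.
HB.instance Definition _ := EqQuotient.on abelianization.

Definition ab : G -> abelianization := \pi.

Lemma abP x y : ab x = ab y <-> derived_subgroup (x / y).
Proof.
split=> [xy|xy]; last by apply/eqmodP/asboolP.
by have /eqmodP/asboolP := xy.
Qed.

Lemma abI (a : abelianization) : exists x, a = ab x.
Proof. by exists (repr a); rewrite /ab reprK. Qed.

Definition ab_add (a b : abelianization) := ab (repr a * repr b).
Definition ab_opp (a : abelianization) := ab (repr a)^-1.

Lemma derived_repr x : derived_subgroup (repr (ab x) / x).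
Proof. by apply/abP; rewrite /ab reprK. Qed.

(** Independence of representatives: the two errors [x' / x] and [y' / y] lie in the derived
    subgroup, and normality absorbs the conjugation of the second. *)
Lemma ab_addE x y : ab_add (ab x) (ab y) = ab (x * y).
Proof.
apply/abP; set x' := repr _; set y' := repr _.
have -> : x' * y' / (x * y) = (x' / x) * (y' / y) ^ x^-1.
  by rewrite conjgE invgK invgM !mulgA mulgVK.
by apply: derived_subgroupM; [|apply: derived_subgroupJ]; apply: derived_repr.
Qed.

Lemma ab_oppE x : ab_opp (ab x) = ab x^-1.
Proof.
apply/abP; set x' := repr _.
have -> : x'^-1 / x^-1 = ((x' / x)^-1) ^ x.
  by rewrite conjgE invgF invgK !mulgA mulVg mul1g.
exact/derived_subgroupJ/derived_subgroupV/derived_repr.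
Qed.

Lemma ab_addA : associative ab_add.
Proof.
move=> a b c; have [x ->] := abI a; have [y ->] := abI b; have [z ->] := abI c.
by rewrite !ab_addE mulgA.
Qed.

Lemma ab_addC : commutative ab_add.
Proof.
move=> a b; have [x ->] := abI a; have [y ->] := abI b; rewrite !ab_addE.
apply/abP; rewrite invgM mulgA.
have -> : x * y / x / y = [~ x^-1, y^-1].
  by rewrite /commg conjgE !invgK !mulgA.
exact: derived_subgroupR.
Qed.

Lemma ab_add0 : left_id (ab 1) ab_add.
Proof. by move=> a; have [x ->] := abI a; rewrite ab_addE mul1g. Qed.

Lemma ab_addN : left_inverse (ab 1) ab_opp ab_add.
Proof.
by move=> a; have [x ->] := abI a; rewrite ab_oppE ab_addE mulVg.
Qed.

HB.instance Definition _ :=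
  GRing.isZmodule.Build abelianization ab_addA ab_addC ab_add0 ab_addN.

Lemma abM x y : ab (x * y) = (ab x + ab y)%R.
Proof. by rewrite -ab_addE. Qed.

Lemma ab1 : ab 1 = 0%R. Proof. by []. Qed.

Lemma ab_eq0 x : ab x = 0%R <-> derived_subgroup x.
Proof. by rewrite -ab1 abP divg1. Qed.

End Abelianization.

(** * Norms and limits *)

Section RealNorm.
Variable R : realType.

(** A copy of the norm with values in the totally ordered field [R], where linear and polynomial
    arithmetic apply. *)
Definition rnorm (V : normedZmodType R[i]) (x : V) : R := complex.Re `|x|.

Lemma rnormE (V : normedZmodType R[i]) (x : V) : `|x| = (rnorm x)%:C.
Proof. by rewrite /rnorm RRe_real// normr_real. Qed.

Lemma rnorm_ge0 (V : normedZmodType R[i]) (x : V) : 0 <= rnorm x.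
Proof. by rewrite -ler0c -rnormE. Qed.

Lemma rnorm0 (V : normedZmodType R[i]) : rnorm (0 : V) = 0.
Proof. by rewrite /rnorm normr0. Qed.

Lemma rnorm0_eq0 (V : normedZmodType R[i]) (x : V) : rnorm x = 0 -> x = 0.
Proof. by move=> x0; apply/normr0_eq0; rewrite rnormE x0. Qed.

Lemma rnormN (V : normedZmodType R[i]) (x : V) : rnorm (- x) = rnorm x.
Proof. by rewrite /rnorm normrN. Qed.

Lemma rnormB (V : normedZmodType R[i]) (x y : V) :
  rnorm (x - y) = rnorm (y - x).
Proof. by rewrite -opprB rnormN. Qed.

Lemma rnormD (V : normedZmodType R[i]) (x y : V) :
  rnorm (x + y) <= rnorm x + rnorm y.
Proof. by rewrite -lecR rmorphD/= -!rnormE ler_normD. Qed.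

Lemma rnorm_le_dist (V : normedZmodType R[i]) (z x y : V) :
  rnorm (x - y) <= rnorm (x - z) + rnorm (z - y).
Proof. by rewrite -[x - y](subrKA z) rnormD. Qed.

Lemma rnormZ (V : normedModType R[i]) (c : R[i]) (x : V) :
  rnorm (c *: x) = rnorm c * rnorm x.
Proof.
by apply: (@complexI R); rewrite rmorphM/= -!rnormE normrZ.
Qed.

Lemma rnormCM (c d : R[i]) : rnorm (c * d) = rnorm c * rnorm d.
Proof. by apply: (@complexI R); rewrite rmorphM/= -!rnormE normrM. Qed.

Lemma rnorm_real (x : R) : 0 <= x -> rnorm x%:C = x.
Proof. by move=> x0; rewrite /rnorm ger0_norm// ler0c. Qed.

Lemma rnorm_nat (n : nat) : rnorm (n%:R : R[i]) = n%:R.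
Proof. by rewrite -(rmorph_nat (real_complex R)) rnorm_real. Qed.

Lemma rnormV (c : R[i]) : rnorm c^-1 = (rnorm c)^-1.
Proof. by apply: (@complexI R); rewrite fmorphV/= -!rnormE normfV. Qed.

Lemma half_geo (n : nat) : (2^-1 : R) ^+ n.+1 = 2^-1 * 2^-1 ^+ n.
Proof. by rewrite exprS. Qed.

Lemma half_ge0 (n : nat) : 0 <= (2^-1 : R) ^+ n.
Proof. by apply: exprn_ge0; lra. Qed.

Lemma half_small (c e : R) : 0 < e -> exists n : nat, c * 2^-1 ^+ n < e.
Proof.
move=> e0.
have /cvg_geometric : `|2^-1 : R| < 1 by rewrite ger0_norm; lra.
move=> /(_ c) /cvgrPdist_lt/(_ _ e0)[n _ /(_ n (leqnn _))] /=.
by rewrite sub0r normrN => /(le_lt_trans (ler_norm _)) ?; exists n.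
Qed.

(** Replaces passages to the limit: equalities are proved below by bounding a distance by a multiple
    of [2^-1 ^+ n] for every [n]. *)
Lemma le_half_geo (x c : R) : (forall n : nat, x <= c * 2^-1 ^+ n) -> x <= 0.
Proof.
move=> xc; rewrite leNgt; apply/negP => /(half_small c)[n].
by rewrite ltNge xc.
Qed.

End RealNorm.

Section Complete.
Variables (R : realType) (V : completeNormedModType R[i]).

(** The factor 2 sums the geometric tail. The explicit rate feeds [le_half_geo]. *)
Lemma geometric_cvg (x : nat -> V) (c : R) :
  (forall n, rnorm (x n.+1 - x n) <= c * 2^-1 ^+ n) ->
  exists l, forall n, rnorm (x n - l) <= 2 * c * 2^-1 ^+ n.
Proof.
move=> xc.
have c0 : 0 <= c by have := xc 0; rewrite expr0 mulr1; apply/le_trans/rnorm_ge0.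
have tail n m : rnorm (x (n + m)%N - x n) <= 2 * c * 2^-1 ^+ n.
  (* This is the exact finite geometric sum, for which the induction on [m] closes. *)
  suff : rnorm (x (n + m)%N - x n) <= 2 * c * 2^-1 ^+ n * (1 - 2^-1 ^+ m).
    move=> /le_trans; apply; rewrite ler_piMr ?gerBl ?half_ge0//.
    by rewrite mulr_ge0 ?half_ge0//; lra.
  elim: m => [|m IHm].
    by rewrite addn0 !subrr rnorm0 mulr0.
  rewrite addnS (le_trans (rnorm_le_dist (x (n + m)%N) _ _))//.
  have := xc (n + m)%N; rewrite exprD exprS.
  set g := 2^-1 ^+ m in IHm *; set h := 2^-1 ^+ n in IHm *; lra.
have : cvgn x.
  apply/cauchy_cvgP/cauchy_exP => e e0.
  have re0 : 0 < complex.Re e by move: e0; rewrite ltcE => /andP[].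
  have [n nP] := half_small (2 * c) re0.
  exists (x n); exists n => // m /= nm.
  rewrite -ball_normE /ball_ /= rnormE.
  have -> : e = (complex.Re e)%:C by rewrite RRe_real// gtr0_real.
  rewrite ltcR rnormB; apply: le_lt_trans nP.
  by rewrite -(subnKC nm).
move=> /cvg_ex[l xl]; exists l => n.
rewrite leNgt; apply/negP => nl.
pose e : R := rnorm (x n - l) - 2 * c * 2^-1 ^+ n.
have e0 : 0 < e%:C :> R[i] by rewrite ltcR subr_gt0.
move/cvgrPdist_lt : xl => /(_ _ e0)[m _ /(_ (n + m)%N (leq_addl _ _))] /=.
rewrite rnormE ltcR; have := rnorm_le_dist (x (n + m)%N) (x n) l.
have := tail n m.
rewrite (rnormB (x n) (x _)) (rnormB l _) /e; lra.
Qed.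

End Complete.

(** * Boundedness of states *)

Section CStarNorm.
Variables (R : realType) (A : cstarAlgebra R).
Implicit Types x y : A.

Lemma starK : involutive (@star R A). Proof. exact: cstar_starK. Qed.

Lemma starD : {morph @star R A : x y / x + y}.
Proof. exact: cstar_starD. Qed.

Lemma starM x y : star (x * y) = star y * star x.
Proof. exact: cstar_starM. Qed.

Lemma starZ (c : R[i]) x : star (c *: x) = Num.conj c *: star x.
Proof. exact: cstar_starZ. Qed.

Lemma starN x : star (- x) = - star x.
Proof. by rewrite -scaleN1r starZ rmorphN rmorph1 scaleN1r. Qed.

Lemma starB x y : star (x - y) = star x - star y.
Proof. by rewrite starD starN. Qed.

Lemma star0 : star (0 : A) = 0.
Proof. by rewrite -(scale0r (0 : A)) starZ rmorph0 !scale0r. Qed.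

Lemma star1 : star (1 : A) = 1.
Proof. by rewrite -[LHS]mulr1 -{2}[1]starK -starM mulr1 starK. Qed.

Lemma rnormM x y : rnorm (x * y) <= rnorm x * rnorm y.
Proof.
rewrite -lecR rmorphM/= -!rnormE.
exact: (@cstar_normM R A).
Qed.

Lemma rnorm_starM x : rnorm (star x * x) = rnorm x ^+ 2.
Proof.
apply: (@complexI R); rewrite rmorphXn/= -!rnormE.
exact: (@cstar_norm_starM R A).
Qed.

(** The C*-identity and submultiplicativity bound the square of the norm of [y] by the product of
    the norms of [star y] and [y]; cancel, then apply this to [star x] as well. *)
Lemma rnorm_star x : rnorm (star x) = rnorm x.
Proof.
have le_star y : rnorm y <= rnorm (star y).
  have [y0|y0] := leP (rnorm y) 0; first exact: le_trans y0 (rnorm_ge0 _).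
  by rewrite -(ler_pM2r y0) -expr2 -rnorm_starM rnormM.
by apply/eqP; rewrite eq_le le_star -{2}[x]starK le_star.
Qed.

Lemma rnorm1 : rnorm (1 : A) = 1.
Proof.
have n0 : rnorm (1 : A) != 0.
  by apply/eqP => /rnorm0_eq0/eqP; rewrite oner_eq0.
by apply: (mulfI n0); rewrite -expr2 -rnorm_starM star1 !mulr1.
Qed.

Lemma rnormX x n : rnorm (x ^+ n) <= rnorm x ^+ n.
Proof.
elim: n => [|n IHn]; first by rewrite !expr0 rnorm1.
by rewrite !exprS (le_trans (rnormM _ _))// ler_wpM2l ?rnorm_ge0.
Qed.

Lemma rnorm_half x : rnorm (2^-1 *: x) = 2^-1 * rnorm x.
Proof. by rewrite rnormZ rnormV rnorm_nat. Qed.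

End CStarNorm.

Section SquareRoot.
Variables (R : realType) (A : cstarAlgebra R) (h : A).
Hypotheses (star_h : star h = h) (norm_h : rnorm h <= 2^-1).

(* The square root of [1 - h] is [1 - y], where [y] is the fixed point of
   [y |-> (h + y ^ 2) / 2], a contraction of the ball of radius [1 / 2]. *)
Let step (y : A) : A := 2^-1 *: (h + y * y).

Let seq_y n := iter n step 0.

Let seq_y_le n : rnorm (seq_y n) <= 2^-1.
Proof.
elim: n => [|n IHn]; first by rewrite /seq_y/= rnorm0; lra.
rewrite /seq_y/= -/(seq_y n) /step rnorm_half.
have := rnormD h (seq_y n * seq_y n); have := rnormM (seq_y n) (seq_y n).
have := rnorm_ge0 (seq_y n); move: IHn norm_h.
nra.
Qed.

Let step_contr y z : rnorm y <= 2^-1 -> rnorm z <= 2^-1 ->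
  rnorm (step y - step z) <= 2^-1 * rnorm (y - z).
Proof.
move=> yle zle; rewrite -scalerBr rnorm_half opprD addrACA subrr add0r.
have -> : y * y - z * z = y * (y - z) + (y - z) * z.
  by rewrite mulrBr mulrBl addrA subrK.
have := rnormD (y * (y - z)) ((y - z) * z).
have := rnormM y (y - z); have := rnormM (y - z) z.
have := rnorm_ge0 (y - z); nra.
Qed.

Let star_seq n : star (seq_y n) = seq_y n.
Proof.
elim: n => [|n IHn]; first exact: star0.
rewrite /seq_y/= -/(seq_y n) /step starZ starD starM IHn star_h.
by rewrite fmorphV/= rmorph_nat.
Qed.

Lemma exists_sqrt_one_sub : exists b : A, star b * b = 1 - h.
Proof.
have [|y yP] := @geometric_cvg R A seq_y (2^-1).
  elim=> [|n IHn].
    rewrite /seq_y/= subr0 -[X in step X]/(seq_y 0) expr0 mulr1.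
    exact: (seq_y_le 1).
  rewrite half_geo mulrCA.
  apply: (le_trans (step_contr (seq_y_le n.+1) (seq_y_le n))).
  by rewrite ler_wpM2l//; lra.
have star_y : star y = y.
  apply/eqP; rewrite -subr_eq0; apply/eqP/rnorm0_eq0/eqP.
  rewrite eq_le rnorm_ge0 andbT; apply: (@le_half_geo _ _ 2) => n.
  apply: le_trans (rnorm_le_dist (seq_y n) _ _) _.
  rewrite -{1}star_seq -starB rnorm_star (rnormB y).
  have := yP n; lra.
have norm_y : rnorm y <= 2^-1.
  rewrite -subr_le0; apply: (@le_half_geo _ _ 1) => n.
  have := rnormD (y - seq_y n) (seq_y n); rewrite subrK rnormB.
  have := yP n; have := seq_y_le n; lra.
have fix_y : y = step y.
  apply/eqP; rewrite -subr_eq0; apply/eqP/rnorm0_eq0/eqP.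
  rewrite eq_le rnorm_ge0 andbT; apply: (@le_half_geo _ _ 1) => n.
  apply: le_trans (rnorm_le_dist (seq_y n.+1) _ _) _.
  have := step_contr (seq_y_le n) norm_y; rewrite -/(seq_y n.+1).
  have := yP n.+1; rewrite half_geo (rnormB y).
  have := yP n; rewrite -[step (seq_y n)]/(seq_y n.+1); lra.
exists (1 - y); rewrite starB star1 star_y mulrBl mul1r mulrBr mulr1.
(* Twice the fixed-point equation; it turns the square of [1 - y] into [1 - h]. *)
have -> : y * y = y + y - h.
  rewrite {3 4}fix_y -mulr2n -scaler_nat scalerA mulfV ?pnatr_eq0// scale1r.
  by rewrite addrC addKr.
by rewrite -[y + y - h]addrA (opprD y (y - h)) addNKr !opprB addrA subrK.
Qed.

End SquareRoot.

Section StateBound.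
Variables (R : realType) (A : cstarAlgebra R) (tau : {scalar A}).
Hypotheses (tau_ge0 : forall a : A, 0 <= tau (star a * a)) (tau1 : tau 1 = 1).

(** Both [1 - h] and [1 + h] have the form [star b * b], so positivity of [tau] puts [tau h] between
    -1 and 1. *)
Let tau_sa_small (h : A) : star h = h -> rnorm h <= 2^-1 ->
  rnorm (tau h) <= 1.
Proof.
have half (k : A) : star k = k -> rnorm k <= 2^-1 -> tau k <= 1.
  move=> sk nk; have [b bk] := exists_sqrt_one_sub sk nk.
  by have := tau_ge0 b; rewrite bk linearB/= tau1 subr_ge0.
move=> sh nh; have hle := half h sh nh.
have := half (- h); rewrite starN sh rnormN => /(_ erefl nh).
rewrite linearN/= lerNl => leh.
by rewrite -lecR -rnormE real_ler_norml ?ler1_real// leh hle.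
Qed.

Let tau_sa (h : A) : star h = h -> rnorm (tau h) <= 2 * rnorm h.
Proof.
move=> sh; have [h0|h0] := leP (rnorm h) 0.
  have -> : h = 0 by apply/rnorm0_eq0/eqP; rewrite eq_le h0 rnorm_ge0.
  by rewrite linear0 !rnorm0 mulr0.
pose c : R := (2 * rnorm h)^-1.
have c0 : 0 < c by rewrite invr_gt0 mulr_gt0.
have nc : rnorm c%:C = c by rewrite rnorm_real// ltW.
have := @tau_sa_small (c%:C *: h).
rewrite starZ sh conj_Creal; last by apply/complex_realP; exists c.
rewrite linearZ/= rnormCM rnormZ nc => /(_ erefl) => H.
have : c * rnorm (tau h) <= 1.
  by apply: H; rewrite /c invfM -mulrA mulVf ?mulr1// gt_eqF.
by rewrite /c mulrC ler_pdivrMr ?mulr_gt0// mul1r.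
Qed.

(** Write [a = h + 'i *: k] with [h] and [k] self-adjoint of norm at most that of [a]; each
    contributes a factor 2. *)
Lemma state_bounded (a : A) : rnorm (tau a) <= 4 * rnorm a.
Proof.
pose h := 2^-1 *: (a + star a); pose k := (- ('i / 2)) *: (a - star a).
have sh : star h = h.
  by rewrite starZ starD starK fmorphV/= rmorph_nat addrC.
have sk : star k = k.
  rewrite starZ starB starK rmorphN rmorphM/= conjCi fmorphV/= rmorph_nat.
  by rewrite mulNr opprK -opprB scalerN -scaleNr.
have ni : rnorm ('i : R[i]) = 1 by rewrite /rnorm normCi.
have hk : h + 'i *: k = a.
  rewrite scalerA mulrN mulrA -expr2 sqrCi mulN1r opprK /h -scalerDr.
  rewrite addrACA subrr addr0 -mulr2n -[a *+ 2]scaler_nat scalerA.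
  by rewrite mulVf ?scale1r// pnatr_eq0.
rewrite -{1}hk linearD [tau (_ *: k)]linearZ/=.
have := rnormD (tau h) ('i * tau k); rewrite rnormCM ni.
have nh : rnorm h <= rnorm a.
  by rewrite rnorm_half; have := rnormD a (star a); rewrite rnorm_star; lra.
have nk : rnorm k <= rnorm a.
  rewrite rnormZ rnormN rnormCM ni rnormV rnorm_nat.
  by have := rnormD a (- star a); rewrite rnormN rnorm_star; lra.
have := tau_sa sh; have := tau_sa sk; lra.
Qed.

End StateBound.

(** * The logarithm series *)

Section LogSeries.
Variables (R : realType) (A : cstarAlgebra R).
Implicit Types a h y : A.

Lemma rnorm_exp_small a n :
  rnorm a <= 4^-1 -> rnorm (a ^+ n) <= 2^-1 ^+ n.
Proof.
move=> na; apply: le_trans (rnormX _ _) _.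
by apply: lerXn2r; rewrite ?nnegrE ?rnorm_ge0//; lra.
Qed.

Lemma rnorm_exp_small4 a n :
  rnorm a <= 4^-1 -> rnorm (a ^+ n.+1) <= 4^-1 * 2^-1 ^+ n.
Proof.
move=> na; rewrite exprS; apply: le_trans (rnormM _ _) _.
by apply: ler_pM; rewrite ?rnorm_ge0// rnorm_exp_small.
Qed.

(** Partial sums of the Neumann series for the inverse of [1 + a]. *)
Definition geo_sum n a : A := \sum_(k < n) (- a) ^+ k.

Lemma mul_geo_sum n a : (1 + a) * geo_sum n a = 1 - (- a) ^+ n.
Proof.
have := subrX1 (- a) n; rewrite -/(geo_sum n a) => /(congr1 -%R).
by rewrite opprB -mulNr opprB opprK => ->.
Qed.

Lemma geo_sumC n a : geo_sum n a * (1 + a) = (1 + a) * geo_sum n a.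
Proof.
apply/esym/commr_sum => i _; apply/commrX/commrN/commr_sym/commrD;
  by [exact: commr1 | exact: commr_refl].
Qed.

Lemma geo_sumE n a y : y * (1 + a) = 1 -> geo_sum n a = y - y * (- a) ^+ n.
Proof.
move=> ya; rewrite -{1}[y]mulr1 -mulrBr -mul_geo_sum mulrA ya.
by rewrite mul1r.
Qed.

Lemma exists_left_inverse a : rnorm a <= 4^-1 -> exists y, y * (1 + a) = 1.
Proof.
move=> na; have nNa : rnorm (- a) <= 4^-1 by rewrite rnormN.
have [|y yP] := @geometric_cvg R A (geo_sum ^~ a) 1.
  move=> n; rewrite /geo_sum big_ord_recr/= addrAC subrr add0r mul1r.
  exact: rnorm_exp_small.
exists y; apply/eqP; rewrite -subr_eq0; apply/eqP/rnorm0_eq0/eqP.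
rewrite eq_le rnorm_ge0 andbT.
apply: (@le_half_geo _ _ (2 * rnorm (1 + a) + 1)) => n.
apply: le_trans (rnorm_le_dist (geo_sum n a * (1 + a)) _ _) _.
have -> : geo_sum n a * (1 + a) - 1 = - (- a) ^+ n.
  by rewrite geo_sumC mul_geo_sum addrAC subrr add0r.
rewrite rnormN -mulrBl; have := rnorm_exp_small n nNa.
have := rnormM (y - geo_sum n a) (1 + a).
have := yP n; rewrite mulr1 rnormB => yn.
have := ler_wpM2r (rnorm_ge0 (1 + a)) yn; lra.
Qed.

(** The Mercator coefficient of degree [k.+1]: the index is shifted by one. *)
Definition log_coef k : R[i] := (-1) ^+ k / k.+1%:R.

Lemma log_coef_le1 k : rnorm (log_coef k) <= 1.
Proof.
rewrite /log_coef rnormCM rnormV rnorm_nat.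
have -> : rnorm ((-1) ^+ k : R[i]) = 1 by rewrite /rnorm normrX normrN1 expr1n.
by rewrite mul1r invf_le1 ?ltr0n// ler1n.
Qed.

Definition log_sum n a : A := \sum_(k < n) log_coef k *: a ^+ k.+1.

Lemma log_sum0 n : log_sum n 0 = 0.
Proof.
by rewrite /log_sum big1// => k _; rewrite expr0n/= scaler0.
Qed.

(** On the ball of radius 1/4 the terms are dominated by [4^-1 * 2^-1 ^+ n]. Outside it the values
    of [l] are unconstrained. *)
Lemma exists_log1p : {l : A -> A | forall a n, rnorm a <= 4^-1 ->
  rnorm (log_sum n a - l a) <= 2^-1 ^+ n}.
Proof.
apply/cid; have /choice[l lP] : forall a, exists l, rnorm a <= 4^-1 ->
    forall n, rnorm (log_sum n a - l) <= 2^-1 ^+ n.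
  move=> a; have [na|na] := pselect (rnorm a <= 4^-1); last by exists 0.
  have [|l lP] := @geometric_cvg R A (log_sum ^~ a) 4^-1.
    move=> m; rewrite /log_sum big_ord_recr/= addrAC subrr add0r rnormZ.
    rewrite -[leRHS]mul1r; apply: ler_pM; rewrite ?rnorm_ge0//.
      exact: log_coef_le1.
    exact: rnorm_exp_small4.
  exists l => _ m; apply: le_trans (lP m) _.
  by have := half_ge0 R m; lra.
by exists l => a n /lP.
Qed.

Definition log1p : A -> A := sval exists_log1p.

Lemma log1pP a n : rnorm a <= 4^-1 ->
  rnorm (log_sum n a - log1p a) <= 2^-1 ^+ n.
Proof.
by move=> na; rewrite /log1p; case: exists_log1p => l /= /(_ a n na).
Qed.

(* The terms of [(a + h) ^ k] that are linear in [h]. *)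
Fixpoint dpow k a h : A :=
  if k is k'.+1 then dpow k' a h * a + a ^+ k' * h else 0.

Definition rempow k a h : A := (a + h) ^+ k - a ^+ k - dpow k a h.

Lemma rempowS k a h :
  rempow k.+1 a h = rempow k a h * (a + h) + dpow k a h * h.
Proof.
rewrite /rempow /= !exprSr mulrBl mulrBl [a ^+ k * (a + h)]mulrDr.
rewrite [dpow k a h * (a + h)]mulrDr !opprD !addrA subrK.
by rewrite addrAC.
Qed.

(** The constant 4 here, and 16 in [rnorm_rempow], are those for which the recursions reproduce the
    bound with ratio 1/2. *)
Lemma rnorm_dpow k a h : rnorm a <= 4^-1 ->
  rnorm (dpow k a h) <= 4 * 2^-1 ^+ k * rnorm h.
Proof.
move=> na; have h0 := rnorm_ge0 h.
elim: k => [|k IHk] /=; first by rewrite rnorm0 expr0 mulr1 mulr_ge0.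
have := rnormD (dpow k a h * a) (a ^+ k * h).
have := rnormM (dpow k a h) a; have := rnormM (a ^+ k) h.
have := ler_wpM2r h0 (rnorm_exp_small k na).
have := ler_pM (rnorm_ge0 _) (rnorm_ge0 _) IHk na.
rewrite half_geo; lra.
Qed.

Lemma rnorm_rempow k a h : rnorm a <= 4^-1 -> rnorm (a + h) <= 4^-1 ->
  rnorm (rempow k a h) <= 16 * 2^-1 ^+ k * rnorm h ^+ 2.
Proof.
move=> na nah; have h0 := rnorm_ge0 h.
elim: k => [|k IHk].
  by rewrite /rempow /= !expr0 subrr subr0 rnorm0 mulr1 mulr_ge0// sqr_ge0.
rewrite rempowS; have := rnormD (rempow k a h * (a + h)) (dpow k a h * h).
have := rnormM (rempow k a h) (a + h); have := rnormM (dpow k a h) h.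
have := ler_pM (rnorm_ge0 _) (rnorm_ge0 _) IHk nah.
have := ler_wpM2r h0 (rnorm_dpow k h na).
rewrite half_geo expr2; lra.
Qed.

End LogSeries.

(** Stands in for the constancy of functions with zero derivative: bisecting an interval halves the
    quadratic bound on the increment, and [n] bisections divide it by the [n]-th power of 2. *)
Lemma quadratic_increments_const (R : realType) (V : normedZmodType R[i])
    (g : R -> V) (c : R) :
  (forall s t, 0 <= s <= 1 -> 0 <= t <= 1 ->
     rnorm (g s - g t) <= c * (s - t) ^+ 2) ->
  g 1 = g 0.
Proof.
move=> gc; apply/eqP; rewrite -subr_eq0; apply/eqP/rnorm0_eq0/eqP.
rewrite eq_le rnorm_ge0 andbT; apply: (@le_half_geo _ _ c) => n.
suff gn s t : 0 <= s <= 1 -> 0 <= t <= 1 ->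
    rnorm (g s - g t) <= c * (s - t) ^+ 2 * 2^-1 ^+ n.
  by have := gn 1 0; rewrite subr0 expr1n mulr1; apply; rewrite ?lexx ?ler01.
elim: n s t => [|n IHn] s t s01 t01; first by rewrite expr0 mulr1 gc.
pose m := (s + t) / 2; have m01 : 0 <= m <= 1 by rewrite /m; lra.
apply: le_trans (rnorm_le_dist (g m) _ _) _.
have := IHn s m s01 m01; have := IHn m t m01 t01.
have -> : s - m = (s - t) / 2 by rewrite /m; field.
have -> : m - t = (s - t) / 2 by rewrite /m; field.
rewrite half_geo expr_div_n expr2 -natrX; lra.
Qed.

(** * The trace of the logarithm *)

Section TraceLog.
Variables (R : realType) (A : cstarAlgebra R) (tau : {scalar A}).
Hypothesis tau_bounded : forall a : A, rnorm (tau a) <= 4 * rnorm a.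
Hypothesis tau1 : tau 1 = 1.
Hypothesis tauC : forall a b : A, tau (a * b) = tau (b * a).
Implicit Types a b h y : A.

Let tauD a b : tau (a + b) = tau a + tau b. Proof. exact: linearD. Qed.
Let tauZ (c : R[i]) a : tau (c *: a) = c * tau a. Proof. exact: linearZ. Qed.

Definition trlog a : R[i] := tau (log1p a).

Lemma trlogP a n : rnorm a <= 4^-1 ->
  rnorm (tau (log_sum n a) - trlog a) <= 4 * 2^-1 ^+ n.
Proof.
move=> na; rewrite -linearB; apply: le_trans (tau_bounded _) _.
by rewrite ler_pM2l//; apply: log1pP.
Qed.

Lemma trlog_unique a b : rnorm a <= 4^-1 -> rnorm b <= 4^-1 ->
  (forall n, tau (log_sum n a) = tau (log_sum n b)) -> trlog a = trlog b.
Proof.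
move=> na nb ab; apply/eqP; rewrite -subr_eq0; apply/eqP/rnorm0_eq0/eqP.
rewrite eq_le rnorm_ge0 andbT; apply: (@le_half_geo _ _ 8) => n.
apply: le_trans (rnorm_le_dist (tau (log_sum n a)) _ _) _.
have := trlogP n na; have := trlogP n nb.
rewrite -ab (rnormB (trlog a) (tau _)); lra.
Qed.

Lemma trlog0 : trlog 0 = 0.
Proof.
apply/rnorm0_eq0/eqP; rewrite eq_le rnorm_ge0 andbT.
apply: (@le_half_geo _ _ 4) => n.
have := @trlogP 0 n; rewrite rnorm0 log_sum0 linear0 sub0r rnormN; apply.
by lra.
Qed.

(** Under a trace all words with [k] letters [a] before or after one [h] agree up to the extra power
    [j]. That power absorbs the right factor [a] in the recursion of [dpow]. *)
Lemma tau_dpow k j a h :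
  tau (dpow k.+1 a h * a ^+ j) = k.+1%:R * tau (a ^+ (k + j)%N * h).
Proof.
elim: k j => [|k IHk] j.
  by rewrite /= mul0r add0r expr0 !mul1r add0n tauC.
rewrite -[dpow k.+2 a h]/(dpow k.+1 a h * a + a ^+ k.+1 * h) mulrDl linearD/=.
rewrite -mulrA -exprS IHk [tau (_ * a ^+ j)]tauC mulrA -exprD.
by rewrite addnS addSn [(j + k.+1)%N]addnC addSn -[k.+2%:R]natr1 mulrDl mul1r.
Qed.

(** The factor [k.+1] from [tau_dpow] cancels the denominator of [log_coef], so the linear parts add
    up to the Neumann sum. *)
Lemma tau_log_sumB n a h :
  tau (log_sum n (a + h)) - tau (log_sum n a) =
  tau (geo_sum n a * h) + tau (\sum_(k < n) log_coef R k *: rempow k.+1 a h).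
Proof.
rewrite -linearB /log_sum -sumrB /geo_sum mulr_suml -linearD/= -big_split/=.
rewrite !linear_sum; apply: eq_bigr => k _ /=.
rewrite -scalerBr.
have -> : (a + h) ^+ k.+1 - a ^+ k.+1 = dpow k.+1 a h + rempow k.+1 a h.
  by rewrite /rempow addrCA subrr addr0.
rewrite scalerDr !tauD; congr (_ + _).
rewrite tauZ; have := tau_dpow k 0 a h; rewrite expr0 mulr1 addn0 => ->.
rewrite mulrA /log_coef mulfVK ?pnatr_eq0// [in RHS]exprNn.
rewrite -[X in X * tau _]signr_odd -[X in X * a ^+ k]signr_odd.
by case: (odd k); rewrite ?expr0 ?expr1 ?mul1r// !mulN1r mulNr [RHS]linearN.
Qed.

(** First-order expansion: the derivative at [a] in direction [h] is the trace of the inverse of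
    [1 + a] times [h], with a quadratic error uniform on the ball. Here [64 = 4 * 16] combines the
    bounds of [tau] and of the remainders. *)
Lemma trlog_increment a h y :
  rnorm a <= 4^-1 -> rnorm (a + h) <= 4^-1 -> y * (1 + a) = 1 ->
  rnorm (trlog (a + h) - trlog a - tau (y * h)) <= 64 * rnorm h ^+ 2.
Proof.
move=> na nah ya; rewrite -subr_le0.
have h0 := rnorm_ge0 h.
(* The truncation errors: 4 from each of two uses of [trlogP], and the last term from the Neumann
   tail [y * (- a) ^+ n * h]. *)
apply: (@le_half_geo _ _ (8 + 4 * (rnorm y * rnorm h))) => n.
rewrite lerBlDl.
pose r := \sum_(k < n) log_coef R k *: rempow k.+1 a h.
have nr : rnorm r <= 16 * rnorm h ^+ 2.
  suff : rnorm r <= 16 * rnorm h ^+ 2 * (1 - 2^-1 ^+ n).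
    move=> /le_trans; apply; rewrite ler_piMr ?gerBl ?half_ge0//.
    by rewrite mulr_ge0 ?sqr_ge0.
  rewrite /r {r}; elim: n => [|n IHn].
    by rewrite big_ord0 rnorm0 expr0 subrr mulr0.
  rewrite big_ord_recr/=; apply: le_trans (rnormD _ _) _.
  have : rnorm (log_coef R n *: rempow n.+1 a h) <=
      16 * 2^-1 ^+ n.+1 * rnorm h ^+ 2.
    rewrite rnormZ -[leRHS]mul1r; apply: ler_pM; rewrite ?rnorm_ge0//.
      exact: log_coef_le1.
    exact: rnorm_rempow.
  by move: IHn; rewrite half_geo; lra.
have -> : trlog (a + h) - trlog a - tau (y * h) =
    - (tau (log_sum n (a + h)) - trlog (a + h)) +
    ((tau (log_sum n a) - trlog a) +
    (tau r - tau (y * (- a) ^+ n * h))).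
  have := tau_log_sumB n a h; rewrite (geo_sumE _ ya) mulrBl linearB/= -/r.
  move=> /(canRL (subrK _)) ->; ring.
have := rnormD (- (tau (log_sum n (a + h)) - trlog (a + h)))
    ((tau (log_sum n a) - trlog a) + (tau r - tau (y * (- a) ^+ n * h))).
have := rnormD (tau (log_sum n a) - trlog a)
   (tau r - tau (y * (- a) ^+ n * h)).
have := rnormD (tau r) (- tau (y * (- a) ^+ n * h)).
rewrite !rnormN.
have := trlogP n na; have := trlogP n nah; have := tau_bounded r.
have := tau_bounded (y * (- a) ^+ n * h).
have := rnormM (y * (- a) ^+ n) h.
have : rnorm (y * (- a) ^+ n) * rnorm h <= rnorm y * 2^-1 ^+ n * rnorm h.
  rewrite ler_wpM2r//; apply: le_trans (rnormM _ _) _.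
  by rewrite ler_wpM2l ?rnorm_ge0// rnorm_exp_small// rnormN.
lra.
Qed.

(* Along [t |-> (1 + a)(1 + t b)] the derivative of [trlog] is
   [tau ((1 + t b)^-1 b)], which is also its derivative along [1 + t b]. *)
Lemma trlogM a b : rnorm a <= 16^-1 -> rnorm b <= 16^-1 ->
  trlog (a + b + a * b) = trlog a + trlog b.
Proof.
move=> na nb.
pose p (t : R) := a + t%:C *: (b + a * b); pose q (t : R) := t%:C *: b.
pose g t := trlog (p t) - trlog (q t).
have nab : rnorm (b + a * b) <= 8^-1.
  have := rnormD b (a * b); have := rnormM a b.
  have := ler_pM (rnorm_ge0 a) (rnorm_ge0 b) na nb; lra.
have nC (t : R) : 0 <= t <= 1 -> rnorm t%:C <= 1.
  by move=> /andP[t0 t1]; rewrite rnorm_real.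
have np t : 0 <= t <= 1 -> rnorm (p t) <= 4^-1.
  move=> t01; have := rnormD a (t%:C *: (b + a * b)); rewrite rnormZ.
  have := ler_pM (rnorm_ge0 t%:C) (rnorm_ge0 (b + a * b)) (nC t t01) nab.
  rewrite /p; lra.
have nq t : 0 <= t <= 1 -> rnorm (q t) <= 4^-1.
  move=> t01; rewrite rnormZ.
  by have := ler_pM (rnorm_ge0 t%:C) (rnorm_ge0 b) (nC t t01) nb; lra.
have g10 : g 1 = g 0.
  pose c := 64 * (rnorm (b + a * b) ^+ 2 + rnorm b ^+ 2).
  apply: (@quadratic_increments_const _ _ g c) => s t s01 t01.
  have [y1 y1P] : exists y, y * (1 + a) = 1.
    by apply: exists_left_inverse; lra.
  have [y2 y2P] := exists_left_inverse (nq t t01).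
  have yP : y2 * y1 * (1 + p t) = 1.
    have -> : 1 + p t = (1 + a) * (1 + q t).
      rewrite mulrDl !mulrDr !mul1r mulr1 /p /q -scalerAr scalerDr -[RHS]addrA.
      by congr (_ + _); rewrite addrCA.
    by rewrite mulrA -[y2 * y1 * _]mulrA y1P mulr1.
  have ps : p s = p t + (s - t)%:C *: (b + a * b).
    by rewrite /p -addrA -scalerDl -rmorphD/= (addrC t) subrK.
  have qs : q s = q t + (s - t)%:C *: b.
    by rewrite /q -scalerDl -rmorphD/= (addrC t) subrK.
  have := @trlog_increment (p t) ((s - t)%:C *: (b + a * b)) (y2 * y1)
    (np t t01).
  rewrite -ps => /(_ (np s s01) yP).
  have := @trlog_increment (q t) ((s - t)%:C *: b) y2 (nq t t01).
  rewrite -qs => /(_ (nq s s01) y2P).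
  (* As [b + a * b = (1 + a) * b] and [y1 * (1 + a) = 1], the first-order terms of both paths
     coincide and cancel in [g]. *)
  have -> : y2 * y1 * ((s - t)%:C *: (b + a * b)) = y2 * ((s - t)%:C *: b).
    rewrite -!scalerAr; congr (_ *: _).
    rewrite -[X in X + _]mul1r -mulrDl mulrA -[y2 * y1 * _]mulrA y1P.
    by rewrite mulr1.
  set T := tau _; set u := trlog (p s) - _ - _; set w := trlog (q s) - _ - _.
  have -> : g s - g t = u - w by rewrite /g /u /w; ring.
  have := rnormD u (- w); rewrite rnormN !rnormZ.
  have -> : rnorm (s - t)%:C = `|s - t|.
    by rewrite /rnorm normc_def/= expr0n/= addr0 sqrtr_sqr.
  rewrite !exprMn real_normK ?num_real// /c; lra.
move: g10; rewrite /g /p /q !scale1r !scale0r addr0 trlog0 subr0 addrA => <-.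
by rewrite subrK.
Qed.

Lemma trlogJ a y z : rnorm a <= 4^-1 -> rnorm (z * a * y) <= 4^-1 ->
  y * z = 1 -> trlog (z * a * y) = trlog a.
Proof.
move=> na nzay yz; apply: trlog_unique => // n.
rewrite /log_sum !linear_sum; apply: eq_bigr => k _ /=; rewrite !linearZ/=.
congr (_ * _).
have -> : (z * a * y) ^+ k.+1 = z * a ^+ k.+1 * y.
  elim: (k : nat) => [|m IHm]; first by rewrite !expr1.
  rewrite exprS IHm [in RHS]exprS !mulrA; congr (_ * _ * _).
  by rewrite -[z * a * y * z]mulrA yz mulr1.
by rewrite tauC mulrA yz mul1r.
Qed.

(** Expanding at 0, [trlog] differs from [z] by at most 64 times the square of its norm, which
    forces [z = 0] below radius 1/64. *)
Lemma trlog_scalar_eq0 (z : R[i]) :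
  rnorm z < 64^-1 -> trlog z%:A = 0 -> z = 0.
Proof.
move=> nz lz; have nzA : rnorm (z%:A : A) = rnorm z.
  by rewrite rnormZ rnorm1 mulr1.
have := @trlog_increment 0 z%:A 1.
rewrite rnorm0 add0r nzA lz trlog0 subrr (mul1r z%:A) tauZ tau1 mulr1 sub0r.
rewrite rnormN addr0 mulr1 => H.
have {H} : rnorm z <= 64 * rnorm z ^+ 2 by apply: H => //; lra.
move=> zz; apply/rnorm0_eq0/eqP; rewrite eq_le rnorm_ge0 andbT leNgt.
by apply/negP => z0; move: zz; rewrite expr2; nra.
Qed.

End TraceLog.

(** * The unitary group *)

Section LocalClassFunction.
Variables (R : realType) (G : groupType) (W : zmodType).
Variables (nu : G -> R) (L : G -> W) (r : R).
Hypothesis nu1 : nu 1%g = 0.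
Hypothesis nuM : forall x y, nu (x * y)%g <= nu x + nu y.
Hypothesis nuV : forall x, nu x^-1%g = nu x.
Hypothesis nuJ : forall x y, nu (x ^ y)%g = nu x.
Hypothesis LM : forall x y, nu x <= r -> nu y <= r -> L (x * y)%g = L x + L y.
Hypothesis LJ : forall x y, nu x <= r -> L (x ^ y)%g = L x.

(** The correction [z] is a product of conjugates of the inverses of [a] and [b] and of [a] and [b]
    themselves. Each has length at most [d], and their values under [L] cancel in pairs. *)
Lemma comm_perturbation (d : R) (x y a b : G) :
    0 <= d -> nu a <= d -> nu b <= d -> 4 * d <= r ->
  exists z, [/\ nu z <= 4 * d, L z = 0
    & [~ x * a, y * b]%g = (z * [~ x, y])%g].
Proof.
move=> d0 na nb dr.
have nu0 : nu 1%g <= r by rewrite nu1; lra.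
have L1 : L 1%g = 0.
  by apply: (@addrI _ (L 1%g)); rewrite -LM// mulg1 addr0.
have LV c : nu c <= r -> L c^-1%g = - L c.
  move=> nc; apply: (@addrI _ (L c)); rewrite -LM ?nuV// mulgV L1.
  by rewrite subrr.
set z1 := a^-1%g; set z2 := (b^-1 ^ x)%g; set z3 := (a ^ (x^-1 * y * x))%g.
set z4 := (b ^ ([~ x, y]^-1))%g.
have n1 : nu z1 <= d by rewrite nuV.
have n2 : nu z2 <= d by rewrite nuJ nuV.
have n3 : nu z3 <= d by rewrite nuJ.
have n4 : nu z4 <= d by rewrite nuJ.
have n34 := nuM z3 z4; have n234 := nuM z2 (z3 * z4)%g.
exists (z1 * (z2 * (z3 * z4)))%g; split.
- by have := nuM z1 (z2 * (z3 * z4))%g; lra.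
- have Lz1 : L z1 = - L a by rewrite LV//; lra.
  have Lz2 : L z2 = - L b by rewrite LJ ?LV ?nuV//; lra.
  have Lz3 : L z3 = L a by rewrite LJ//; lra.
  have Lz4 : L z4 = L b by rewrite LJ//; lra.
  have -> : L (z1 * (z2 * (z3 * z4)))%g = L z1 + (L z2 + (L z3 + L z4)).
    by rewrite LM ?(LM (x := z2)) ?(LM (x := z3))//; lra.
  by rewrite Lz1 Lz2 Lz3 Lz4 [L a + _]addrC addKr addNr.
rewrite /z1 /z2 /z3 /z4 /commg /conjg !invgM !invgK !mulgA.
by rewrite !(mulgK, mulgVK).
Qed.

(** [all2] also forces the lists to have equal length. *)
Definition near_pairs (d : R) : seq (G * G) -> seq (G * G) -> bool :=
  all2 (fun p q =>
    (nu (p.1^-1 * q.1)%g <= d) && (nu (p.2^-1 * q.2)%g <= d)).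

(** The correction of the tail is moved to the left of the leading commutator by a conjugation,
    which changes neither [nu] nor [L]; each commutator adds at most [4 * d] to the length. *)
Lemma prod_comm_perturbation (d : R) s t : 0 <= d ->
    near_pairs d s t -> 4 * d * (size s)%:R <= r ->
  exists z, [/\ nu z <= 4 * d * (size s)%:R, L z = 0
    & prod_comm t = (z * prod_comm s)%g].
Proof.
move=> d0; elim: s t => [|p s IHs] [|q t]//=.
  move=> _; rewrite mulr0 => r0; exists 1%g; rewrite nu1 mul1g; split=> //.
  by apply: (@addrI _ (L 1%g)); rewrite -LM ?nu1// mulg1 addr0.
move=> /andP[/andP[n1 n2] st].
rewrite -[(size s).+1%:R]natr1 mulrDr mulr1 => sr.
have ds0 : 0 <= 4 * d * (size s)%:R by rewrite !mulr_ge0.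
have [|z [nz Lz tz]] := IHs t st; first by lra.
have [|z' [nz' Lz' tz']] := comm_perturbation p.1 p.2 d0 n1 n2; first by lra.
rewrite !mulVKg in tz'.
have nJ := nuJ z [~ p.1, p.2]^-1%g.
exists (z' * z ^ ([~ p.1, p.2]^-1))%g; split.
- by have := nuM z' (z ^ ([~ p.1, p.2]^-1))%g; lra.
- by rewrite LM ?LJ ?Lz ?Lz' ?addr0//; lra.
rewrite !prod_comm_cons tz' tz; move: [~ p.1, p.2]%g => c.
by rewrite conjgE invgK !mulgA mulgVK.
Qed.

End LocalClassFunction.

Section UnitaryGroup.
Variables (R : realType) (A : cstarAlgebra R).

(** Boolean membership makes this a subtype, so that unitaries are equal as soon as their values in
    [A] are. *)
Definition unitary := {u : A | u \in unitary_group A}.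

HB.instance Definition _ := SubChoice.on unitary.

Definition mk_unitary (a : A) (a_unitary : a \in unitary_group A) : unitary :=
  exist _ a a_unitary.

Lemma unitaryP (u : unitary) :
  star (val u) * val u = 1 /\ val u * star (val u) = 1.
Proof. exact: set_mem (valP u). Qed.

Lemma unitary_mul_in (u v : unitary) : val u * val v \in unitary_group A.
Proof.
have [uu uu'] := unitaryP u; have [vv vv'] := unitaryP v.
apply/mem_set; split; rewrite starM mulrA.
  by rewrite -[_ * _ * val u]mulrA uu mulr1.
by rewrite -[_ * _ * star (val v)]mulrA vv' mulr1.
Qed.

Lemma unitary_star_in (u : unitary) : star (val u) \in unitary_group A.
Proof.
have [uu uu'] := unitaryP u.
by apply/mem_set; split; rewrite starK.
Qed.

Lemma unitary_one_in : (1 : A) \in unitary_group A.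
Proof. by apply/mem_set; split; rewrite star1 mulr1. Qed.

Definition unitary_mul u v : unitary := mk_unitary (unitary_mul_in u v).
Definition unitary_inv u : unitary := mk_unitary (unitary_star_in u).
Definition unitary_one : unitary := mk_unitary unitary_one_in.

Lemma unitary_mulA : associative unitary_mul.
Proof. by move=> u v w; apply/val_inj; rewrite /= mulrA. Qed.

Lemma unitary_mul1 : left_id unitary_one unitary_mul.
Proof. by move=> u; apply/val_inj; rewrite /= mul1r. Qed.

Lemma unitary_1mul : right_id unitary_one unitary_mul.
Proof. by move=> u; apply/val_inj; rewrite /= mulr1. Qed.

Lemma unitary_mulV : left_inverse unitary_one unitary_inv unitary_mul.
Proof. by move=> u; apply/val_inj; case: (unitaryP u). Qed.

Lemma unitary_Vmul : right_inverse unitary_one unitary_inv unitary_mul.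
Proof. by move=> u; apply/val_inj; case: (unitaryP u). Qed.

HB.instance Definition _ := isGroup.Build unitary
  unitary_mulA unitary_mul1 unitary_1mul unitary_mulV unitary_Vmul.

Lemma val_unitaryM (u v : unitary) : val (u * v)%g = val u * val v.
Proof. by []. Qed.

Lemma val_unitaryV (u : unitary) : val u^-1%g = star (val u).
Proof. by []. Qed.

Lemma val_unitary1 : val (1%g : unitary) = 1.
Proof. by []. Qed.

Lemma val_unitaryJ (u v : unitary) :
  val (u ^ v)%g = star (val v) * val u * val v.
Proof. by rewrite -mulrA. Qed.

Lemma rnorm_unitary (u : unitary) : rnorm (val u) = 1.
Proof.
have [uu _] := unitaryP u; have := rnorm_starM (val u); rewrite uu rnorm1.
by move=> /esym/eqP; rewrite sqrp_eq1 ?rnorm_ge0// => /eqP.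
Qed.

Lemma rnorm_mul_unitary (u : unitary) (a : A) : rnorm (val u * a) = rnorm a.
Proof.
have [uu _] := unitaryP u.
apply/eqP; rewrite eq_le; apply/andP; split.
  by have := rnormM (val u) a; rewrite rnorm_unitary mul1r.
have := rnormM (star (val u)) (val u * a).
by rewrite mulrA uu mul1r rnorm_star rnorm_unitary mul1r.
Qed.

Lemma rnorm_unitary_mul (u : unitary) (a : A) : rnorm (a * val u) = rnorm a.
Proof.
rewrite -rnorm_star starM -val_unitaryV rnorm_mul_unitary.
exact: rnorm_star.
Qed.

Definition expi (t : R) : R[i] := cos t +i* sin t.

Lemma expi0 : expi 0 = 1.
Proof. by rewrite /expi cos0 sin0. Qed.

Lemma expiD s t : expi (s + t) = expi s * expi t.
Proof.
rewrite /expi cosD sinD; apply/eqP; rewrite eq_complex /=.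
by rewrite addrC eqxx [sin s * _ + _]addrC eqxx.
Qed.

Lemma expiN_mul t : expi (- t) * expi t = 1.
Proof. by rewrite -expiD addNr expi0. Qed.

Lemma norm_expi t : `|expi t| = 1.
Proof. by rewrite normc_def/= cos2Dsin2 sqrtr1. Qed.

Lemma conj_expi t : Num.conj (expi t) = expi (- t).
Proof.
have := normCKC (expi t); rewrite norm_expi expr1n => e.
by rewrite -[LHS]mulr1 -(expiN_mul t) mulrA mulrAC -e mul1r.
Qed.

Lemma expi_in t : (expi t)%:A \in unitary_group A.
Proof.
have starE : star ((expi t)%:A : A) = (expi (- t))%:A.
  by rewrite starZ star1 conj_expi.
apply/mem_set; rewrite /unitary_group /= starE; split.
  by rewrite -scalerAl mul1r scalerA expiN_mul scale1r.
by rewrite -scalerAl mul1r scalerA mulrC expiN_mul scale1r.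
Qed.

Definition uexpi t : unitary := mk_unitary (expi_in t).

Lemma val_uexpi t : val (uexpi t) = (expi t)%:A.
Proof. by []. Qed.

Lemma uexpiD s t : uexpi (s + t) = (uexpi s * uexpi t)%g.
Proof.
by apply/val_inj; rewrite val_unitaryM !val_uexpi -scalerAl mul1r scalerA expiD.
Qed.

Lemma expi_eq1_small t : `|t| < pi -> expi t = 1 -> t = 0.
Proof.
rewrite ltr_norml => /andP[ltt tlt] [_ st].
apply/eqP; apply: contraT; rewrite neq_lt => /orP[t0|t0].
  have := @sin_gt0_pi _ (- t); rewrite sinN st oppr0 ltxx => H.
  by have := H _; rewrite oppr_gt0 t0 ltrNl; apply.
by have := @sin_gt0_pi _ t; rewrite st ltxx t0 tlt; apply.
Qed.

End UnitaryGroup.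

(** * Scalars in the derived subgroup *)

(** Each point is coded by a point of a countable dense set within [e / 2] of it. This turns
    separability into the injectivity of a code. *)
Lemma separable_code (R : realType) (V : normedModType R[i]) (e : R) :
  separable_space V -> 0 < e ->
  exists c : V -> nat, forall x y, c x = c y -> rnorm (x - y) <= e.
Proof.
move=> [D /countable_injP[f f_inj] denseD] e0.
have e2 : 0 < (e / 2)%:C by rewrite ltcR; lra.
have /choice[p pP] : forall x : V, exists d, D d /\ rnorm (x - d) <= e / 2.
  move=> x; have [|d [xd Dd]] := denseD (ball x (e / 2)%:C) _ (ball_open x _).
    by exists x; apply: ballxx.
  exists d; split=> //; apply: ltW.
  by move: xd; rewrite -ball_normE /ball_ /= rnormE ltcR.
exists (f \o p) => x y /= /f_inj pxy.
have [[Dx xp] [Dy yp]] := (pP x, pP y).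
apply: le_trans (rnorm_le_dist (p x) _ _) _.
have {2}-> : p x = p y by apply: pxy; apply/mem_set.
by rewrite (rnormB (p y)); lra.
Qed.

Section ScalarCommutators.
Variables (R : realType) (A : cstarAlgebra R) (tau : {scalar A}).
Hypotheses (hsep : separable_space A) (htau : tracial_state tau).

Let G := unitary A.

Let nu (u : G) : R := rnorm (val u - 1).

Let L (u : G) : R[i] := trlog tau (val u - 1).

(** Within the radius 1/16 of [trlogM] and strictly below the radius 1/64 of [trlog_scalar_eq0]. *)
Let r : R := 128^-1.

Let tau_bounded (a : A) : rnorm (tau a) <= 4 * rnorm a.
Proof. by case: htau => pos one _; apply: state_bounded. Qed.

Let nu1 : nu 1%g = 0.
Proof. by rewrite /nu val_unitary1 subrr rnorm0. Qed.

Let nuM (u v : G) : nu (u * v)%g <= nu u + nu v.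
Proof.
rewrite /nu val_unitaryM.
have -> : val u * val v - 1 = (val u - 1) * val v + (val v - 1).
  by rewrite mulrBl mul1r addrA subrK.
by apply: le_trans (rnormD _ _) _; rewrite rnorm_unitary_mul.
Qed.

Let nuV (u : G) : nu u^-1%g = nu u.
Proof.
by rewrite /nu val_unitaryV -{1}(star1 A) -starB rnorm_star.
Qed.

Let val_conj (u v : G) : val (u ^ v)%g - 1 = star (val v) * (val u - 1) * val v.
Proof.
by rewrite val_unitaryJ mulrBr mulrBl mulr1; case: (unitaryP v) => ->.
Qed.

Let nuJ (u v : G) : nu (u ^ v)%g = nu u.
Proof.
by rewrite /nu val_conj rnorm_unitary_mul -val_unitaryV rnorm_mul_unitary.
Qed.

Let LM (u v : G) : nu u <= r -> nu v <= r -> L (u * v)%g = L u + L v.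
Proof.
case: htau => _ tau1 tauC; rewrite /nu /r => nu_u nu_v.
have nu_u' : rnorm (val u - 1) <= 16^-1 by lra.
have nu_v' : rnorm (val v - 1) <= 16^-1 by lra.
rewrite /L -(trlogM tau_bounded tauC nu_u' nu_v'); congr (trlog tau _).
rewrite val_unitaryM [(val u - 1) * _]mulrBl mul1r -[RHS]addrA.
by rewrite [val v - 1 + _]addrC subrK mulrBr mulr1 [RHS]addrC addrA subrK.
Qed.

Let LJ (u v : G) : nu u <= r -> L (u ^ v)%g = L u.
Proof.
case: htau => _ tau1 tauC; rewrite /L => nu_u.
have nuJ_u : nu (u ^ v)%g <= r by rewrite nuJ.
rewrite val_conj (trlogJ tau_bounded tauC) -?val_conj//.
- by move: nu_u; rewrite /nu /r; lra.
- by move: nuJ_u; rewrite /nu /r; lra.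
- by case: (unitaryP v).
Qed.

Lemma countable_scalar_commutators :
  countable [set t : R | derived_subgroup (uexpi A t)].
Proof.
(* Since [512 = 4 * 128], moving the entries of [n] commutators by [d n] keeps the total length
   [4 * d n * n] within [r]. *)
pose d n : R := 512^-1 / n.+1%:R.
have d0 n : 0 < d n by rewrite /d divr_gt0.
have /choice[c cP] : forall n, exists c : A -> nat,
    forall x y, c x = c y -> rnorm (x - y) <= d n.
  by move=> n; apply: separable_code.
have /choice[s sP] : forall t : R, exists s : seq (G * G),
    derived_subgroup (uexpi A t) -> prod_comm s = uexpi A t.
  move=> t; have [[s _ <-]|] := pselect (derived_subgroup (uexpi A t)).
    by exists s.
  by exists [::].
(* Equal codes force lists of equal length, hence entries coded at the same mesh. The floor
   distinguishes parameters that the periodic [expi] would identify. *)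
pose code t : int * seq (nat * nat) := (Num.floor t,
  [seq (c (size (s t)) (val p.1), c (size (s t)) (val p.2)) | p <- s t]).
apply/countable_injP; exists (pickle \o code) => t t' /set_mem Kt /set_mem Kt'.
move=> /(pcan_inj pickleK) [tt' /[dup] /(congr1 size)].
rewrite !size_map => size_ss'; rewrite -size_ss'; set n := size (s t) => cc'.
have near_ss' : near_pairs nu (d n) (s t) (s t').
  have near1 (u v : G) : c n (val u) = c n (val v) -> nu (u^-1 * v)%g <= d n.
    move=> /cP; rewrite rnormB => uv.
    rewrite /nu val_unitaryM val_unitaryV; have [<- _] := unitaryP u.
    by rewrite -mulrBr -val_unitaryV rnorm_mul_unitary.
  elim: (s t) (s t') cc' => [|p s1 IHs] [|q s2] //= [c1 c2 /IHs ->].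
  by rewrite !near1.
have dn : 4 * d n * n%:R <= r.
  have : n%:R / n.+1%:R <= 1 :> R by rewrite ler_pdivrMr// mul1r ler_nat.
  by rewrite /d /r; move: n.+1%:R^-1 n%:R => x y; nra.
have [z [nz Lz]] :=
  prod_comm_perturbation nu1 nuM nuV nuJ LM LJ (ltW (d0 n)) near_ss' dn.
rewrite !sP// => e.
have {}e : z = uexpi A (t' - t).
  apply: (@mulIg G (uexpi A t)); rewrite -e -uexpiD.
  by rewrite subrK.
have {nz} nz : nu z <= r by apply: le_trans nz dn.
case: htau => _ tau1 tauC.
have z1 : val z - 1 = (expi (t' - t) - 1)%:A.
  by rewrite e val_uexpi scalerBl scale1r.
have : expi (t' - t) - 1 = 0.
  apply: (trlog_scalar_eq0 tau_bounded tau1 tauC); last first.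
    by rewrite -z1; exact: Lz.
  have := nz; rewrite /nu z1 rnormZ rnorm1 mulr1 /r => le_r.
  by apply: (le_lt_trans le_r); lra.
move=> /eqP; rewrite subr_eq0 => /eqP /expi_eq1_small et.
apply/eqP; rewrite eq_sym -subr_eq0 et//.
(* With equal floors, [t] and [t'] differ by less than 1, hence by less than [pi]. *)
have := floor_itv t; have := floor_itv t'; rewrite -tt' intrD.
have := pi_ge2 R; rewrite ltr_norml; lra.
Qed.

End ScalarCommutators.

(** * The automorphism *)

(** The excluded [t] form a countable union of countable sets, which is Lebesgue null, whereas the
    unit interval is not. *)
Lemma exists_rationally_independent (R : realType) (K : set R) :
  countable K -> exists t, forall n (q : rat), ~ K (t *+ n.+1 - ratr q).
Proof.
move=> cK; apply: contrapT => /forallNP noT.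
pose B := \bigcup_(p in [set: nat * rat])
  [set (k + ratr p.2) / p.1.+1%:R | k in K].
have cB : countable B.
  apply: bigcup_countable => // p _.
  exact: sub_countable (card_image_le _ _) cK.
have BT : B = setT.
  apply/seteqP; split=> // t _.
  have /existsNP[n /existsNP[q /contrapT Kt]] := noT t.
  exists (n, q) => //=; exists (t *+ n.+1 - ratr q) => //.
  by rewrite subrK -mulr_natr mulfK ?pnatr_eq0.
have : (lebesgue_measure (`[0%R, 1%R]%classic : set R) <= 0)%E.
  rewrite -(countable_lebesgue_measure0 cB) BT.
  by apply: le_measure; rewrite ?inE//; exact: measurableT.
by rewrite lebesgue_measure_itv/= lte_fin ltr01 sube0 lee_fin ler10.
Qed.

Section PhaseCharacter.
Variables (R : realType) (A : cstarAlgebra R).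

(** Apply [exists_rational_character] in the abelianization, with [S] the classes of the rational
    phases and [v] the class of [uexpi A t0]. A positive multiple [n] of [v] in [S] would put some
    [n t0 - q] in the excluded countable set. *)
Lemma exists_phase_character :
    countable [set t : R | derived_subgroup (uexpi A t)] ->
  exists (f : unitary A -> rat) (t0 : R),
    [/\ forall u v, f (u * v)%g = f u + f v,
        forall q, f (uexpi A (ratr q)) = 0 & f (uexpi A t0) = 1].
Proof.
move=> /exists_rationally_independent[t0 t0P].
pose ph t := ab (uexpi A t).
have phD s t : ph (s + t) = ph s + ph t by rewrite /ph uexpiD abM.
have ph0 : ph 0 = 0 by apply: (@addrI _ (ph 0)); rewrite -phD !addr0.
have phN t : ph (- t) = - ph t.
  by apply: (@addrI _ (ph t)); rewrite -phD !subrr.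
have phMn t n : ph (t *+ n) = ph t *+ n.
  by elim: n => [|n IHn]; rewrite ?mulr0n// !mulrS phD IHn.
pose S := [set ph (ratr q) | q in [set: rat]].
have [||f [fD fS ft0]] := @exists_rational_character _ S (ph t0).
- split; first by exists 0; rewrite // rmorph0.
  by move=> _ _ [q _ <-] [q' _ <-]; exists (q - q'); rewrite // rmorphB phD phN.
- move=> n [q _ qn]; apply: (t0P n q) => /=; apply/ab_eq0.
  by rewrite -/(ph _) phD phN phMn -qn subrr.
exists (f \o @ab _), t0; split=> // [u v|q] /=; first by rewrite abM fD.
by apply: fS; exists q.
Qed.

Lemma expi_cts (t e : R) : 0 < e ->
  exists2 d, 0 < d & forall s, `|t - s| < d -> rnorm (expi t - expi s) < e.
Proof.
move=> e0; have e2 : 0 < e / 2 by lra.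
have /cvgrPdist_lt/(_ _ e2)/nbhs_ballP[d1 /= d10 d1P] := @continuous_cos R t.
have /cvgrPdist_lt/(_ _ e2)/nbhs_ballP[d2 /= d20 d2P] := @continuous_sin R t.
exists (Num.min d1 d2); first by rewrite lt_min d10.
move=> s; rewrite lt_min => /andP[/d1P /= cs /d2P /= ss].
have -> : expi t - expi s =
    (cos t - cos s)%:C + 'i%C * (sin t - sin s)%:C.
  by apply/eqP; rewrite eq_complex /=; apply/andP; split; apply/eqP; ring.
have := rnormD (cos t - cos s)%:C ('i%C * (sin t - sin s)%:C).
rewrite rnormCM.
have nR (x : R) : rnorm x%:C = `|x|.
  by rewrite /rnorm normc_def/= expr0n/= addr0 sqrtr_sqr.
have -> : rnorm ('i%C : R[i]) = 1.
  by rewrite /rnorm normc_def/= expr0n/= add0r expr1n sqrtr1.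
rewrite !nR; lra.
Qed.

(** The circle of all [expi s *: u] is connected, consists of unitaries and meets at [u] a connected
    set of unitaries containing 1, so their union is connected. *)
Lemma U0_phase t u : U0 A u -> U0 A (expi t *: u).
Proof.
move=> [C [C1 CU cC] Cu].
pose T := range (fun s => expi s *: u).
exists (C `|` T); last by right; exists t.
have Uu := CU _ Cu; split; first by left.
  move=> x [/CU//|[s _ <-]].
  have [w ->] : exists w : unitary A, u = val w.
    by exists (mk_unitary (mem_set Uu)).
  have -> : expi s *: val w = val (uexpi A s * w)%g.
    by rewrite val_unitaryM val_uexpi -scalerAl mul1r.
  exact: set_mem (valP _).
apply: connectedU => //.
  by exists u; split=> //; exists 0; rewrite // expi0 scale1r.
apply: connected_continuous_connected.
  by apply/connected_intervalP.
apply: continuous_subspaceT => s.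
apply/cvgrPdist_lt => e e0.
have re0 : 0 < complex.Re e by move: e0; rewrite ltcE => /andP[].
have n0 : 0 < rnorm u + 1 by have := rnorm_ge0 u; lra.
have [d d0 dP] := expi_cts s (divr_gt0 re0 n0).
apply/nbhs_ballP; exists d => // s' /= /dP.
rewrite ltr_pdivlMr// => lt_e.
rewrite -scalerBl rnormE.
have -> : e = (complex.Re e)%:C by rewrite RRe_real// gtr0_real.
rewrite ltcR rnormZ; have := rnorm_ge0 (expi s - expi s'); lra.
Qed.

Lemma U0_unitary u : U0 A u -> unitary_group A u.
Proof. by move=> [C [_ CU _] /CU]. Qed.

Lemma U0_1 : U0 A 1.
Proof.
exists [set 1]; last by [].
split=> //; last exact: connected1.
by move=> _ ->; apply/set_mem/unitary_one_in.
Qed.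

End PhaseCharacter.

Lemma expi1_neq1 (R : realType) : expi (1 : R) != 1.
Proof.
apply/eqP => /expi_eq1_small; rewrite normr1 => H.
have /H/eqP : 1 < pi :> R by have := pi_ge2 R; lra.
by rewrite oner_eq0.
Qed.

Theorem theorem6p6 (R : realType) (A : cstarAlgebra R)
    (hsep : separable_space A)
    (htr : exists tau : {scalar A}, tracial_state tau) :
  exists phi : A -> A,
    group_automorphism (U0 A) phi /\ ~ {within U0 A, continuous phi}.
Proof.
have [tau htau] := htr.
have [f [t0 [fM fq ft0]]] :=
  exists_phase_character (countable_scalar_commutators hsep htau).
(* [F] extends [f] from the unitaries to all of [A] by the default value 0. *)
pose F (u : A) : rat := oapp f 0 (insub u).
have FE (w : unitary A) : F (val w) = f w by rewrite /F valK.
have valU u : U0 A u -> exists w : unitary A, u = val w.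
  by move=> /U0_unitary/mem_set Uu; exists (mk_unitary Uu).
pose phi (u : A) : A := expi (ratr (F u)) *: u.
have phaseE t (w : unitary A) : expi t *: val w = val (uexpi A t * w)%g.
  by rewrite val_unitaryM val_uexpi -scalerAl mul1r.
(* Since [f] kills rational phases, [phi] preserves [F]. The phase it applied can therefore be read
   off its value and undone. *)
have F_phase q u : U0 A u -> F (expi (ratr q) *: u) = F u.
  by move=> /valU[w ->]; rewrite phaseE !FE fM fq add0r.
exists phi; split.
  split; first split.
  - by move=> u; apply: U0_phase.
  - move=> u v /set_mem Uu /set_mem Uv uv.
    have Fuv : F u = F v.
      by have := congr1 F uv; rewrite /phi !F_phase.
    have := congr1 (fun w => expi (- ratr (F u)) *: w) uv.
    by rewrite /phi -Fuv !scalerA expiN_mul !scale1r.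
  - move=> v Uv; exists (expi (ratr (- F v)) *: v); first exact: U0_phase.
    by rewrite /phi F_phase// scalerA rmorphN mulrC expiN_mul scale1r.
  move=> u v /set_mem/valU[w ->] /set_mem/valU[w' ->]; rewrite /phi.
  by rewrite -val_unitaryM !FE fM rmorphD expiD -scalerAl -scalerAr scalerA.
move=> /subspace_continuousP cphi.
have U0_scalar t : U0 A (expi t)%:A by apply/U0_phase/U0_1.
pose x : A := (expi t0)%:A.
(* Half the distance by which [phi] moves [x], because [f] takes the value 1 at [t0]. *)
pose e : R := rnorm (expi (1 : R) - 1) / 2.
have e0 : 0 < e.
  rewrite divr_gt0// lt_neqAle rnorm_ge0 andbT eq_sym.
  by apply: contra (expi1_neq1 R) => /eqP/rnorm0_eq0/eqP; rewrite subr_eq0.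
have e0' : 0 < e%:C by rewrite ltcR.
have /cvgrPdist_lt/(_ _ e0')/nbhs_ballP[d /= d0 dP] := cphi x (U0_scalar t0).
have rd0 : 0 < complex.Re d by move: d0; rewrite ltcE => /andP[].
have d'0 : 0 < Num.min e (complex.Re d) by rewrite lt_min e0.
have [d1 d10 d1P] := expi_cts t0 d'0.
(* The scalar [expi (ratr q)] is fixed by [phi] and is close enough to [x] both for the continuity
   modulus [d] and for the final triangle inequality. *)
have [q] : exists q, ratr q \in `]t0, (t0 + d1)[.
  by apply: rat_in_itvoo; rewrite ltrDl.
rewrite in_itv/= => /andP[tq qt].
have : `|t0 - ratr q| < d1 by rewrite ltr_norml; lra.
move=> /d1P; rewrite lt_min => /andP[near_e near_d].
have rA (c : R[i]) : rnorm (c%:A : A) = rnorm c by rewrite rnormZ rnorm1 mulr1.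
have := dP (expi (ratr q))%:A.
rewrite -ball_normE /ball_ /= -scalerBl rnormE rA.
have -> : d = (complex.Re d)%:C by rewrite RRe_real// gtr0_real.
rewrite ltcR => /(_ near_d (U0_scalar _)).
have phi_x : phi x = (expi 1 * expi t0)%:A.
  by rewrite /phi /x -val_uexpi FE ft0 rmorph1 scalerA.
have phi_q : phi (expi (ratr q))%:A = (expi (ratr q))%:A.
  by rewrite /phi -val_uexpi FE fq rmorph0 expi0 scale1r.
rewrite /from_subspace phi_x phi_q -scalerBl rnormE rA ltcR.
(* Continuity would put [expi (ratr q)] within [e] of [expi 1 * expi t0], and it is within [e] of
   [expi t0]; but these two points are [2 * e] apart. *)
have := rnorm_le_dist (expi (ratr q)) (expi 1 * expi t0) (expi t0).
have -> : rnorm (expi 1 * expi t0 - expi t0) = 2 * e.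
  rewrite -{2}[expi t0]mul1r -mulrBl rnormCM [rnorm (expi t0)]/rnorm norm_expi.
  by rewrite mulr1 /e; lra.
by rewrite (rnormB (expi (ratr q)) (expi t0)); lra.
Qed.
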